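(* For an odd prime $q$, let $\mathcal N(2q)$ be the number of (centrally) nilpotent loops of order $2q$ up to isomorphism. Then $\mathcal N(2q)$ is asymptotically $2^{(q-2)(q-1)}/(q-1)$, that is, $$\lim_{q\text{ prime},\ q\to\infty}\mathcal N(2q)\cdot\frac{q-1}{2^{(q-2)(q-1)}}=1.$$
   Context: A loop is a set with a binary operation having a two-sided neutral element such that all left and right translations are bijections. The center $Z(Q)$ of a loop $Q$ is the set of all $x\in Q$ with $xy=yx$, $(xy)z=x(yz)$, $(yx)z=y(xz)$, $(yz)x=y(zx)$ for all $y,z\in Q$; it is a normal subloop (kernel of a loop homomorphism). The upper central series is defined by $Z_0(Q)=1$, $Z_{i+1}(Q)/Z_i(Q)=Z(Q/Z_i(Q))$ (with $Z_{i+1}(Q)$ the full preimage in $Q$). $Q$ is (centrally) nilpotent if $Z_n(Q)=Q$ for some $n\ge0$. *)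

(* Defs.v *)
From HB Require Import structures.
From mathcomp Require Import all_boot all_order all_algebra.
From mathcomp Require Import all_classical all_reals all_analysis.
Set Implicit Arguments.
Unset Strict Implicit.
Unset Printing Implicit Defensive.

Definition is_loop (T : Type) (op : T -> T -> T) (e : T) : Prop :=
  [/\ left_id e op, right_id e op,
      forall a : T, bijective (op a)
    & forall a : T, bijective (op^~ a)].

(* The center of the binary system carried by a subset D of T.  Taking D as a
   parameter lets the same definition apply to a loop (D = [set: T]) and to its
   quotients (D = the set of cosets, inside {set T}). *)
Definition center (T : finType) (op : T -> T -> T) (D : {set T}) : {set T} :=
  [set x in D | [forall y in D, forall z in D,
     [&& op x y == op y x,
         op (op x y) z == op x (op y z),
         op (op y x) z == op y (op x z)
       & op (op y z) x == op y (op z x)]]].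

Section Quotient.
Variables (T : finType) (op : T -> T -> T).

Definition coset (N : {set T}) (x : T) : {set T} := [set op x n | n in N].

Definition cosets (N : {set T}) : {set {set T}} := [set coset N x | x : T].

(* When N is a normal subloop the elementwise product of the cosets xN and yN
   is the coset (xy)N, so this is the multiplication of the quotient loop on
   cosets N. *)
Definition coset_mul (A B : {set T}) : {set T} := [set op a b | a in A, b in B].

Fixpoint upper_central (e : T) (i : nat) : {set T} :=
  if i is j.+1 then
    let N := upper_central e j in
    [set x | coset N x \in center coset_mul (cosets N)]
  else [set e].

Definition nilpotent_loop (e : T) : Prop :=
  is_loop op e /\ exists n, upper_central e n = [set: T].

End Quotient.

Definition loop_isomorphic (T U : Type)
    (op : T -> T -> T) (op' : U -> U -> U) : Prop :=
  exists2 f : T -> U, bijective f & {morph f : x y / op x y >-> op' x y}.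

(* Every loop of order n is isomorphic to one with underlying set 'I_n, so
   isomorphism classes are counted among multiplication tables on 'I_n. *)
Definition table (n : nat) := {ffun 'I_n * 'I_n -> 'I_n}.

Definition table_op (n : nat) (m : table n) (x y : 'I_n) : 'I_n := m (x, y).

Definition nilpotent_tables (n : nat) : {set table n} :=
  [set m | `[< exists e, nilpotent_loop (table_op m) e >]].

Definition num_nilpotent_loops (n : nat) : nat :=
  #|equivalence_partition
      (fun m m' : table n => `[< loop_isomorphic (table_op m) (table_op m') >])
      (nilpotent_tables n)|.

(* Main.v *)
(** A nilpotent loop of order 2q has a central involution, and the quotient by
    it is cyclic of order q; hence it is the extension of Z/q by Z/2 given by a
    normalized cocycle, that is, by an arbitrary subset of (F_q^* )^2.  Two such
    extensions are isomorphic exactly when the cocycles are related by an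
    automorphism of Z/q together with a coboundary, because (0,1) is the only
    involution.  The 2^((q-1)^2) cocycles are thus acted upon by a set of
    (q-1) 2^(q-1) transformations, whose orbits are the isomorphism classes.
    This gives the lower bound at once.  Two distinct transformations coincide
    on at most 2^((q-1)^2/2) cocycles, so that all but a negligible part of the
    orbits have full size, which gives the upper bound. *)
Require Import Defs.
From HB Require Import structures.
From mathcomp Require Import all_boot all_order all_algebra.
From mathcomp Require Import all_classical all_reals all_analysis.
From mathcomp Require Import zify ring lra.
(* Restores the names shadowed by the analysis libraries. *)
Import boot.seq boot.fintype boot.finset Defs.
Set Implicit Arguments.
Unset Strict Implicit.
Unset Printing Implicit Defensive.

(** * Central subloops and the upper central series *)

Lemma loop_of_cancel (T : finType) (op : T -> T -> T) (e : T) :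
  left_id e op -> right_id e op -> (forall x, injective (op x)) ->
  (forall x, injective (op^~ x)) -> is_loop op e.
Proof. by move=> ? ? Il Ir; split=> // a; apply: injF_bij. Qed.

Section LoopTheory.
Variables (T : finType) (op : T -> T -> T) (e : T).

Hypothesis opL : is_loop op e.

Lemma loop1x : left_id e op. Proof. by case: opL. Qed.
Lemma loopx1 : right_id e op. Proof. by case: opL. Qed.
Lemma loopI x : injective (op x).
Proof. by case: opL => _ _ /(_ x) /bij_inj. Qed.
Lemma loopIr x : injective (op^~ x).
Proof. by case: opL => _ _ _ /(_ x) /bij_inj. Qed.

Section LeftNuclear.
Variable c : T.
Hypothesis opc : forall x y, op (op c x) y = op c (op x y).

Local Notation pow i := (iter i (op c) e).

(** Left nuclearity of [c] turns multiplication by a power into an iterated translation, so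
    exponents add as in a cyclic group although the loop need not be associative. *)
Lemma lpow_mul i x : op (pow i) x = iter i (op c) x.
Proof. by elim: i => [|i IHi] /=; rewrite ?loop1x // opc IHi. Qed.

Lemma lpowD i j : pow (i + j) = op (pow i) (pow j).
Proof. by rewrite lpow_mul iterD. Qed.

Lemma lpow_inj i j :
  i < order (op c) e -> j < order (op c) e -> pow i = pow j -> i = j.
Proof. by move=> /findex_iter {2}<- /findex_iter {2}<- ->. Qed.

Lemma lpow_order k : pow (k * order (op c) e) = e.
Proof.
elim: k => [|k IHk] //; rewrite mulSn lpowD IHk loopx1.
exact/iter_order/loopI.
Qed.

(* Right multiplication by [x] carries the [op c]-orbit of [e] onto that of
   [x], so all orbits have the same size. *)
Lemma order_lmul x : order (op c) x = order (op c) e.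
Proof.
rewrite /order -[RHS](card_imset _ (@loopIr x)); apply: eq_card => y.
apply/idP/imsetP => [/iter_findex <-|[z /iter_findex <- ->]].
  by exists (pow (findex (op c) x y)); rewrite ?lpow_mul // /in_mem /= fconnect_iter.
by rewrite lpow_mul /in_mem /= fconnect_iter.
Qed.

(** The orbits of the translation partition the loop into pieces of equal size, as in Lagrange's
    theorem. *)
Lemma order_lmul_dvdn : order (op c) e %| #|T|.
Proof.
have := @fcard_order_set _ (op c) (@loopI c) (order (op c) e) T.
move=> <- //; first exact: dvdn_mull.
by apply/fintype.subsetP=> x _; rewrite inE order_lmul.
Qed.

Lemma order_lmul_gt1 : c != e -> 1 < order (op c) e.
Proof.
move=> ce; have := order_gt0 (op c) e; case E: (order _ _) => [|[|n]] // _.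
by have := lpow_order 1; rewrite E /= loopx1 => /eqP; rewrite (negPf ce).
Qed.

End LeftNuclear.

Definition central x :=
  [/\ forall y, op x y = op y x,
      forall y z, op (op x y) z = op x (op y z),
      forall y z, op (op y x) z = op y (op x z)
    & forall y z, op (op y z) x = op y (op z x)].

Lemma centralP x : reflect (central x) (x \in center op [set: T]).
Proof.
rewrite inE in_setT /=; apply: (iffP forall_inP) => [H|[H1 H2 H3 H4] y _].
  have K y z := forall_inP (H y (in_setT y)) z (in_setT z).
  by split=> [y|y z|y z|y z];
    [have := K y y | have := K y z | have := K y z | have := K y z];
    move=> /and4P[/eqP ? /eqP ? /eqP ? /eqP ?].
by apply/forall_inP=> z _; apply/and4P; split; apply/eqP.
Qed.

Section Pull.
Variable u : T.
Hypothesis uC : central u.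

Lemma central_pull_mulr x y : op x (op u y) = op u (op x y).
Proof. by case: uC => H1 H2 H3 _; rewrite -H3 -H1 H2. Qed.

Lemma central_pull_mull x y : op (op u x) y = op u (op x y).
Proof. by case: uC => _ H2 _ _. Qed.

Lemma central_comm x : op x u = op u x.
Proof. by case: uC => H1 _ _ _. Qed.
End Pull.

(** Each condition of centrality compares two words that become equal once [u] is moved to the
    front. *)
Lemma central_of_pull u :
  (forall x, op x u = op u x) -> (forall x y, op x (op u y) = op u (op x y)) ->
  (forall x y, op (op u x) y = op u (op x y)) -> central u.
Proof.
move=> H1 H2 H3; split=> [y|y z|y z|y z]; rewrite ?H1 ?H3 ?H2 //.
Qed.

Lemma central1 : central e.
Proof. by apply: central_of_pull => [x|x y|x y]; rewrite ?loop1x ?loopx1. Qed.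

Lemma centralM u v : central u -> central v -> central (op u v).
Proof.
move=> uC vC; apply: central_of_pull => [x|x y|x y].
- by rewrite (central_pull_mulr uC) (central_comm vC) (central_pull_mull uC).
- by rewrite !(central_pull_mull uC) (central_pull_mulr uC) (central_pull_mulr vC).
- by rewrite !(central_pull_mull uC) (central_pull_mull vC).
Qed.

Lemma central_lpow c i : central c -> central (iter i (op c) e).
Proof. by move=> cC; elim: i => [|i IHi]; [exact: central1 | exact: centralM]. Qed.

Section Cosets.
Variable N : {set T}.
Hypothesis NC : {in N, forall n, central n}.
Hypothesis N1 : e \in N.
Hypothesis NM : {in N &, forall m n, op m n \in N}.

Lemma coset_self x : x \in coset op N x.
Proof. by apply/imsetP; exists e; rewrite ?loopx1. Qed.

Lemma coset_mulr x n : n \in N -> coset op N (op x n) = coset op N x.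
Proof.
move=> nN; apply/eqP; rewrite eqEcard !(card_imset _ (@loopI _)) leqnn andbT.
apply/fintype.subsetP=> y /imsetP[m mN ->]; apply/imsetP; exists (op n m).
  exact: NM.
have nC := NC nN.
by rewrite (central_comm nC) (central_pull_mull nC) (central_pull_mulr nC).
Qed.

Lemma eq_coset x y : reflect (exists2 n, n \in N & y = op x n)
                             (coset op N x == coset op N y).
Proof.
apply: (iffP eqP) => [E|[n nN ->]]; last by rewrite coset_mulr.
by have := coset_self y; rewrite -E => /imsetP.
Qed.

Lemma coset_mulE x y :
  coset_mul op (coset op N x) (coset op N y) = coset op N (op x y).
Proof.
apply/setP=> z; apply/imset2P/imsetP => [[_ _ /imsetP[m mN ->] /imsetP[n nN ->] ->]|].
  exists (op m n); first exact: NM.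
  have mC := NC mN; have nC := NC nN.
  rewrite (central_comm mC x) (central_comm nC y) (central_comm (centralM mC nC)).
  by rewrite !(central_pull_mull mC) (central_pull_mulr nC).
case=> n nN ->; exists x (op y n); [exact: coset_self| |].
  by apply/imsetP; exists n.
have nC := NC nN.
by rewrite !(central_comm nC) (central_pull_mulr nC).
Qed.

Lemma center_cosetP x : reflect
  [/\ forall y, coset op N (op x y) = coset op N (op y x),
      forall y z, coset op N (op (op x y) z) = coset op N (op x (op y z)),
      forall y z, coset op N (op (op y x) z) = coset op N (op y (op x z))
    & forall y z, coset op N (op (op y z) x) = coset op N (op y (op z x))]
  (coset op N x \in center (coset_mul op) (cosets op N)).
Proof.
have inC y : coset op N y \in cosets op N by apply: imset_f.
rewrite inE inC /=; apply: (iffP forall_inP) => [H|[H1 H2 H3 H4] B /imsetP[y _ ->]].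
  have K y z := forall_inP (H _ (inC y)) _ (inC z).
  by split=> [y|y z|y z|y z];
    [have := K y y | have := K y z | have := K y z | have := K y z];
    rewrite !coset_mulE => /and4P[/eqP ? /eqP ? /eqP ? /eqP ?].
apply/forall_inP=> C /imsetP[z _ ->].
by rewrite !coset_mulE H1 H2 H3 H4 !eqxx.
Qed.

(** The quotient is presented through its projection [p], so that later arguments compute with
    elements. Cancellation holds because a central factor can be pulled out before cancelling in the
    original loop. *)
Lemma quotient_loop : exists (U : finType) (op' : U -> U -> U) (p : T -> U),
  [/\ is_loop op' (p e), {morph p : x y / op x y >-> op' x y},
      forall x y, p x = p y <-> exists2 n, n \in N & y = op x n,
      forall A, exists x, A = p x
    & #|U| * #|N| = #|T|].
Proof.
have inC y : coset op N y \in cosets op N by apply: imset_f.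
pose U := {B : {set T} | B \in cosets op N}.
pose p x : U := exist _ (coset op N x) (inC x).
have inM (A B : U) : coset_mul op (val A) (val B) \in cosets op N.
  case: A B => [A /= /imsetP[x _ ->]] [B /= /imsetP[y _ ->]].
  by rewrite coset_mulE.
pose op' (A B : U) : U := exist (fun B => B \in cosets op N) _ (inM A B).
have pE x y : p x = p y <-> exists2 n, n \in N & y = op x n.
  split=> [[/eqP/eq_coset]|/eq_coset/eqP E] //; exact: val_inj.
have pS (A : U) : exists x, A = p x.
  by case: (imsetP (valP A)) => x _ E; exists x; apply: val_inj.
have pM : {morph p : x y / op x y >-> op' x y}.
  by move=> x y; apply: val_inj; rewrite /= coset_mulE.
exists U, op', p; split=> //.
- apply: loop_of_cancel.
  + by move=> A; case: (pS A) => x ->; rewrite -pM loop1x.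
  + by move=> A; case: (pS A) => x ->; rewrite -pM loopx1.
  + move=> A B C; case: (pS A) (pS B) (pS C) => x -> [y ->] [z ->].
    rewrite -!pM => /pE[n nN E]; apply/pE; exists n => //; apply: (@loopI x).
    have nC := NC nN.
    by rewrite E !(central_comm nC) (central_pull_mulr nC).
  + move=> A B C; case: (pS A) (pS B) (pS C) => x -> [y ->] [z ->].
    rewrite -!pM => /pE[n nN E]; apply/pE; exists n => //; apply: (@loopIr x).
    have nC := NC nN.
    by rewrite E !(central_comm nC) (central_pull_mull nC).
(* The cosets partition [T], and each has the size of [N] because translations are injective. *)
- rewrite -[RHS]cardsT card_sig; symmetry; apply: card_uniform_partition.
    by move=> _ /imsetP[x _ ->]; rewrite card_imset //; apply: loopI.
  apply/and3P; split.
  + apply/eqP/setP=> x; rewrite inE; apply/bigcupP.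
    by exists (coset op N x) => //; apply: coset_self.
  + apply/trivIsetP=> _ _ /imsetP[x _ ->] /imsetP[y _ ->]; apply: contraNT.
    case/pred0Pn=> z /andP[/= /imsetP[m mN E] /imsetP[n nN E']].
    by rewrite -(coset_mulr x mN) -(coset_mulr y nN) -E -E'.
  + by apply/negP=> /imsetP[x _ E]; have := coset_self x; rewrite -E inE.
Qed.

End Cosets.

Lemma upper_central1 : upper_central op e 1 = center op [set: T].
Proof.
have H1 : {in [set e], forall n, central n}.
  by move=> n /set1P->; apply: central1.
have H2 : {in [set e] &, forall m n, op m n \in [set e]}.
  by move=> m n /set1P-> /set1P->; rewrite loop1x set11.
have cE x : coset op [set e] x = [set x] by rewrite /coset imset_set1 loopx1.
apply/setP=> x; rewrite /= inE.
apply/(center_cosetP H1 (set11 e) H2)/centralP => -[K1 K2 K3 K4].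
  by split=> [y|y z|y z|y z]; apply: set1_inj;
    [have := K1 y | have := K2 y z | have := K3 y z | have := K4 y z]; rewrite !cE.
by split=> *; congr (coset _ _ _).
Qed.

Lemma upper_central2P x : reflect
  (let Z := center op [set: T] in
   [/\ forall y, coset op Z (op x y) = coset op Z (op y x),
      forall y z, coset op Z (op (op x y) z) = coset op Z (op x (op y z)),
      forall y z, coset op Z (op (op y x) z) = coset op Z (op y (op x z))
    & forall y z, coset op Z (op (op y z) x) = coset op Z (op y (op z x))])
  (x \in upper_central op e 2).
Proof.
rewrite [upper_central _ _ _]/(upper_central op e 2) /=.
have := upper_central1 => /= ->; rewrite inE; apply: center_cosetP.
- by move=> n /centralP.
- exact/centralP/central1.
- by move=> m n /centralP mC /centralP nC; apply/centralP/centralM.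
Qed.

Lemma upper_central_stall i : upper_central op e i.+1 = upper_central op e i ->
  forall n, upper_central op e (i + n) = upper_central op e i.
Proof.
move=> E; elim=> [|n IHn]; first by rewrite addn0.
by rewrite addnS /= IHn -[RHS]E.
Qed.

End LoopTheory.

(** * Nilpotent loops of order 2q *)

Section NilpotentLoops.
Variables (T : finType) (op : T -> T -> T) (e : T).
Hypothesis opL : is_loop op e.

Local Notation central := (central op).

(** Elements with the same image under [p] agree modulo the center, and the identities defining the
    center hold after applying [p] because [V] is an abelian group. *)
Lemma upper_central2_full (V : zmodType) (p : T -> V) :
  (forall x y, p (op x y) = p x + p y)%R ->
  (forall x y, p x = p y -> exists2 z, central z & y = op x z) ->
  upper_central op e 2 = [set: T].
Proof.
move=> pM pE; apply/setP=> x; rewrite in_setT; apply/upper_central2P => //=.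
have cE u v : p u = p v ->
    coset op (center op [set: T]) u = coset op (center op [set: T]) v.
  case/pE=> z /centralP zZ ->; apply/esym/(coset_mulr opL) => //.
  - by move=> n /centralP.
  - by move=> m n=> /centralP mC /centralP nC; apply/centralP/centralM.
split=> [y|y z|y z|y z]; apply: cE; rewrite !pM.
- exact: GRing.addrC.
- by rewrite GRing.addrA.
- by rewrite GRing.addrA.
- by rewrite GRing.addrA.
Qed.

(** A trivial center would make the upper central series stall at [e]. *)
Lemma nilpotent_central_neq1 n : upper_central op e n = [set: T] ->
  1 < #|T| -> exists2 c, central c & c != e.
Proof.
move=> nilT T1; case: (pickP [pred c in center op [set: T] | c != e]) => [c|Z1].
  by case/andP=> /centralP cC ce; exists c.
have Z10 : upper_central op e 1 = upper_central op e 0.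
  rewrite upper_central1 //; apply/setP=> x; rewrite [RHS]inE.
  have := Z1 x; rewrite /=; case: eqP => [-> _|_]; last by rewrite andbT.
  exact/centralP/(central1 opL).
have := upper_central_stall Z10 n; rewrite add0n nilT /= => E.
by move: T1; rewrite -cardsT E cards1.
Qed.

Section CentralInvolution.
Variable a : T.
Hypotheses (aC : central a) (ae : a != e) (aa : op a a = e).

Let A := [set e; a].

Let AC : {in A, forall n, central n}.
Proof. by move=> n /set2P[] ->; first exact: central1. Qed.

Let A1 : e \in A. Proof. exact: set21. Qed.

Let AM : {in A &, forall m n, op m n \in A}.
Proof.
by move=> m n /set2P[] -> /set2P[] ->;
  rewrite !inE ?aa ?(loop1x opL) ?(loopx1 opL) ?eqxx ?orbT.
Qed.

(** Such a [b] is found in the center or, if the center is [A], in the second center; otherwise the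
    series would stall at [A], which has only two elements. *)
Lemma nilpotent_nuclear_mod_involution n : upper_central op e n = [set: T] ->
  2 < #|T| -> exists2 b, b \notin A &
    forall x y, coset op A (op (op b x) y) = coset op A (op b (op x y)).
Proof.
move=> nilT T2; case: (pickP [pred c in center op [set: T] | c \notin A]) => [c|ZA].
  by case/andP=> /centralP cC cA; exists c => // x y; rewrite (central_pull_mull cC).
have ZE : center op [set: T] = A.
  apply/setP=> x; apply/idP/idP => [xZ|/AC /centralP //].
  by have := ZA x; rewrite /= xZ => /negbFE.
have Z1E := upper_central1 opL; rewrite ZE in Z1E.
case: (pickP [pred c in upper_central op e 2 | c \notin A]) => [c|Z2].
  case/andP=> /(upper_central2P opL) /=; rewrite ZE => -[_ H _ _] cA.
  by exists c.
have Z21 : upper_central op e 2 = upper_central op e 1.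
  apply/setP=> x; apply/idP/idP => [xZ|].
    by have := Z2 x; rewrite Z1E inE xZ => /negbFE.
  rewrite Z1E => /AC xC; apply/upper_central2P => //=; case: (xC) => H1 H2 H3 H4.
  by split=> [y|y z|y z|y z]; congr (coset _ _ _); auto.
case: n nilT => [|n] nilT.
  by have := cardsT T; rewrite -nilT cards1 => E; rewrite -E in T2.
have := upper_central_stall Z21 n; rewrite add1n nilT Z1E => E.
by move: T2; rewrite -cardsT E cards2 eq_sym ae.
Qed.

(** The quotient by [A] has prime order [q], so the class of [b], being left nuclear and nontrivial,
    has order [q]; [s] lifts its powers. *)
Lemma cyclic_section (q : nat) (b : T) : prime q -> #|T| = 2 * q ->
  b \notin A ->
  (forall x y, coset op A (op (op b x) y) = coset op A (op b (op x y))) ->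
  exists s : 'F_q -> T,
    [/\ s 0%R = e, forall i j, exists2 n, n \in A & op (s i) (s j) = op (s (i + j)%R) n
      & forall i j m n, m \in A -> n \in A -> op (s i) m = op (s j) n -> i = j].
Proof.
move=> q_pr Tq bA bN.
have [U [op' [p [opL' pM pE pS Uq]]]] := quotient_loop opL AC A1 AM.
have {}Uq : #|U| = q.
  have := Uq; rewrite cards2 (eq_sym e) ae Tq mulnC => /eqP.
  by rewrite eqn_pmul2l // => /eqP.
have pEc x y : coset op A x = coset op A y -> p x = p y.
  by move/eqP=> /(eq_coset opL AC A1 AM) /pE.
have pb : p b != p e.
  apply/eqP=> /esym /pE[n nA]; rewrite (loop1x opL) => E.
  by rewrite E nA in bA.
have bN' x y : op' (op' (p b) x) y = op' (p b) (op' x y).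
  by case: (pS x) (pS y) => u -> [v ->]; rewrite -!pM; apply: pEc.
have ord_q : order (op' (p b)) (p e) = q.
  have := order_lmul_dvdn opL' bN'; rewrite Uq; case/primeP: q_pr => _ H /H.
  by have := order_lmul_gt1 opL' bN' pb; case: eqP => [-> //|_ _ /eqP].
pose s (i : 'F_q) := iter i (op b) e.
have ps i : p (iter i (op b) e) = iter i (op' (p b)) (p e).
  by elim: i => //= i <-; rewrite pM.
exists s; split=> // [i j|i j m n mA nA E].
  have [|n nA ->] := (pE (s (i + j)%R) (op (s i) (s j))).1; last by exists n.
  (* Addition in ['F_q] reduces modulo [q], which is harmless in the quotient because the [q]-th
     power of the class of [b] is neutral. *)
  rewrite /s; have -> : nat_of_ord (i + j)%R = (i + j) %% q.
    exact (congr1 (modn (i + j)) (Fp_cast q_pr)).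
  rewrite pM !ps -(lpowD opL' bN') [in RHS](divn_eq (i + j) q) (lpowD opL' bN').
  by rewrite -[X in _ * X]ord_q (lpow_order opL' bN') (loop1x opL').
have pc k l : l \in A -> p (op (s k) l) = p (s k).
  by move=> lA; apply/esym/pE; exists l.
have E' : iter i (op' (p b)) (p e) = iter j (op' (p b)) (p e).
  by rewrite -!ps -[LHS](pc i m mA) E pc.
have ltq (k : 'F_q) : k < order (op' (p b)) (p e).
  by rewrite ord_q -[X in _ < X](Fp_cast q_pr).
exact/val_inj/(lpow_inj (ltq i) (ltq j) E').
Qed.

End CentralInvolution.

(* The order of the translation by a central [c] divides [2q].  If it is [q],
   the powers of [c] have index two, so that the loop is an abelian group. *)
Lemma central_involution q c : prime q -> odd q -> #|T| = 2 * q ->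
  central c -> c != e -> exists2 a, central a & a != e /\ op a a = e.
Proof.
move=> q_pr q_odd Tq cC ce.
have cN x y : op (op c x) y = op c (op x y) by apply: central_pull_mull.
have powC i : central (iter i (op c) e) by apply: central_lpow.
set n := order (op c) e; have n_gt0 : 0 < n by apply: order_gt0.
have pow_n : iter n (op c) e = e by apply/iter_order/loopI/opL.
have [n_odd|n_even] := boolP (odd n); last first.
  have n2 : n = n./2 + n./2.
    by rewrite addnn -[LHS]odd_double_half (negPf n_even).
  have n2_gt0 : 0 < n./2 by rewrite half_gt0 (order_lmul_gt1 opL cN ce).
  have n2_lt : n./2 < n by rewrite [X in _ < X]n2 -[X in X < _]addn0 ltn_add2l.
  exists (iter n./2 (op c) e) => //; split.
    by apply/eqP=> /(lpow_inj n2_lt n_gt0) E; rewrite E in n2_gt0.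
  by rewrite -(lpowD opL cN) -n2.
have nq : n = q.
  have : n %| q.
    have := order_lmul_dvdn opL cN; rewrite Tq -/n.
    by rewrite Gauss_dvdr // coprime_sym coprime2n.
  have : 1 < n by apply: (order_lmul_gt1 opL cN ce).
  by case/primeP: q_pr => _ H n_gt1 /H/orP[/eqP E|/eqP //]; rewrite E in n_gt1.
have pow_q m : iter (m * q) (op c) e = e by rewrite -nq (lpow_order opL cN).
have q_gt0 := prime_gt0 q_pr.
pose C := [set iter (i : 'I_q) (op c) e | i : 'I_q].
have pow_mod k : iter k (op c) e = iter (k %% q) (op c) e.
  rewrite {1}(divn_eq k q) (lpowD opL cN) pow_q.
  exact: (loop1x opL).
have powIn k : iter k (op c) e \in C.
  by rewrite pow_mod; apply/imsetP; exists (Ordinal (ltn_pmod k q_gt0)).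
have Cq : #|C| = q.
  rewrite card_imset ?card_ord // => i j E; apply/val_inj/(lpow_inj _ _ E);
    by rewrite -/n nq.
have CC : {in C, forall u, central u} by move=> _ /imsetP[i _ ->].
have coverT b : b \notin C -> forall x, exists2 u, u \in C & x = u \/ x = op u b.
  move=> bC x; have disjC : [disjoint C & (fun u => op u b) @: C].
    apply/pred0P=> y; apply/negP=> /andP[/= /imsetP[i _ ->] /imsetP[_ /imsetP[j _ ->] E]].
    (* The power [c^(j (q - 1))] inverts [c^j], so [c^i = c^j b] would put [b] in [C]. *)
    move/negP: bC; apply; suff -> : b = iter (j * q.-1 + i) (op c) e by [].
    rewrite (lpowD opL cN) E -(central_pull_mull (powC _)) -(lpowD opL cN).
    by rewrite addnC -mulnS prednK // pow_q (loop1x opL).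
  have : x \in C :|: (fun u => op u b) @: C.
    suff -> : C :|: (fun u => op u b) @: C = [set: T] by rewrite in_setT.
    apply/eqP; rewrite eqEcard subsetT cardsT Tq cardsU disjoint_setI0 // cards0.
    by rewrite subn0 (card_imset _ (@loopIr _ _ _ opL b)) Cq addnn mul2n leqnn.
  by case/setUP=> [xC|/imsetP[u uC ->]]; [exists x; last left | exists u; last right].
have [b bC] : exists b, b \notin C.
  case: (pickP [pred b | b \notin C]) => [b|CT]; first by exists b.
  have /setP/eq_card : C = [set: T].
    by apply/setP=> x; have /= := CT x => /negbFE ->; rewrite in_setT.
  rewrite Cq cardsT Tq -{1}[q]mul1n => /eqP; rewrite eqn_pmul2r //.
have [k bb] : exists k, op b b = iter k (op c) e.
  case: (coverT b bC (op b b)) => _ /imsetP[i _ ->] [->|/(@loopIr _ _ _ opL b) E].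
    by exists i.
  by rewrite E powIn in bC.
(* Since [b b = c^k] and [q] is odd, [a a = c^(2 j + k) = c^(k q) = e]. *)
pose j := k * q./2; pose a := op (iter j (op c) e) b.
have aa : op a a = e.
  rewrite /a (central_pull_mulr (powC j)) (central_pull_mull (powC j)) bb.
  rewrite -!(lpowD opL cN) addnA addnn /j doubleMr addnC -mulnS.
  have -> : (q./2).*2.+1 = q by rewrite -[RHS]odd_double_half q_odd.
  by rewrite pow_q.
have aC : a \notin C.
  apply/negP=> /imsetP[i _ E]; move/negP: bC; apply.
  suff -> : b = iter (j * q.-1 + i) (op c) e by [].
  rewrite (lpowD opL cN) -E -(central_pull_mull (powC _)) -(lpowD opL cN).
  by rewrite addnC -mulnS prednK // pow_q (loop1x opL).
(* Up to central factors only [e] and [a] remain, so the centrality of [a] reduces to products of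
   these two elements. *)
have normal x : exists u x0, [/\ central u, x = op u x0 & x0 = e \/ x0 = a].
  case: (coverT a aC x) => u /CC uC [->|->]; [exists u, e | exists u, a].
    by rewrite (loopx1 opL); split=> //; left.
  by split=> //; right.
exists a; last by split=> //; apply: contraNneq aC => ->; exact: (powIn 0).
have op1 := loop1x opL; have opx := loopx1 opL.
apply: central_of_pull => [x|x y|x y]; case: (normal x) => u [x0 [uC -> x0E]];
  try case: (normal y) => v [y0 [vC -> y0E]].
- rewrite (central_pull_mulr uC) (central_pull_mull uC).
  by case: x0E => ->; rewrite ?op1 ?opx.
- rewrite !(central_pull_mulr vC) !(central_pull_mull uC) !(central_pull_mulr uC).
  by case: x0E => ->; case: y0E => ->; rewrite ?(op1, opx, aa).
- rewrite !(central_pull_mulr vC) !(central_pull_mulr uC) !(central_pull_mull uC).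
  rewrite !(central_pull_mulr uC).
  by case: x0E => ->; case: y0E => ->; rewrite ?(op1, opx, aa).
Qed.

End NilpotentLoops.

(** * Extensions by Z/2 *)

Import GRing.Theory.
Local Open Scope ring_scope.

Section Extension.
Variable V : finZmodType.
Implicit Types (th : {set V * V}) (s : V -> V) (t : {set V}).

(* A cocycle with values in Z/2 is encoded by its support; [addb] is the
   addition of Z/2. *)
Definition ext_op th (x y : V * bool) : V * bool :=
  (x.1 + y.1, x.2 (+) y.2 (+) ((x.1, y.1) \in th)).

(** The subsets of this set are the supports of the normalized cocycles, which vanish as soon as one
    argument is [0]. *)
Definition off_axes : {set V * V} := setX [set~ 0] [set~ 0].

(* The pullback of [th] along [s] plus the coboundary of the indicator of [t]. *)
Definition twist s t th : {set V * V} :=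
  [set u | ((s u.1, s u.2) \in th) (+)
           ((u.1 \in t) (+) (u.2 \in t) (+) (u.1 + u.2 \in t))].

Section Normalized.
Variable th : {set V * V}.
Hypothesis thN : th \subset off_axes.

Lemma off_axes0l x : ((0, x) \in th) = false.
Proof. by apply/negP=> /(subsetP thN); rewrite !inE eqxx. Qed.

Lemma off_axes0r x : ((x, 0) \in th) = false.
Proof.
by apply/negP=> /(subsetP thN); rewrite !inE eqxx andbF.
Qed.

Lemma ext_loop : is_loop (ext_op th) (0, false).
Proof.
apply: loop_of_cancel => [[x b]|[x b]|[x b] [y c] [z d]|[x b] [y c] [z d]];
  rewrite /ext_op /=.
- by rewrite add0r off_axes0l addbF.
- by rewrite addr0 off_axes0r !addbF.
- by case=> /addrI <- /addIb /addbI <-.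
- by case=> /addIr <- /addIb /addIb <-.
Qed.

Lemma ext_vertical_central b : central (ext_op th) (0, b).
Proof.
apply: central_of_pull => [[x c]|[x c] [y d]|[x c] [y d]];
  rewrite /ext_op /= ?add0r ?addr0 ?off_axes0l ?off_axes0r ?addbF //.
- by rewrite addbC.
- by rewrite !addbA (addbC c b).
- by rewrite !addbA.
Qed.

End Normalized.

(** The projection to [V] is a morphism to an abelian group, and elements of one fiber differ by a
    central [(0, b)]; hence the nilpotency class is at most two. *)
Lemma nilpotent_of_ext th (T : finType) (op : T -> T -> T) :
  th \subset off_axes -> loop_isomorphic (ext_op th) op ->
  exists e, nilpotent_loop op e.
Proof.
move=> thN [f [g fK gK] fM]; have L := ext_loop thN.
have opE x y : op x y = f (ext_op th (g x) (g y)) by rewrite fM !gK.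
have fI := can_inj fK; have gI := can_inj gK.
have opL : is_loop op (f (0, false)).
  apply: loop_of_cancel => [x|x|x y z|x y z] /=; rewrite !opE ?fK.
  - by rewrite (loop1x L) gK.
  - by rewrite (loopx1 L) gK.
  - by move/fI/(loopI L)/gI.
  - by move=> /fI/(loopIr L)/gI.
exists (f (0, false)); split=> //; exists 2.
apply: (upper_central2_full opL (p := fun x => (g x).1)) => [x y|x y E].
  by rewrite opE fK.
exists (f (0, (g x).2 (+) (g y).2)).
  have [H1 H2 H3 H4] := ext_vertical_central thN ((g x).2 (+) (g y).2).
  by split=> *; rewrite !opE !fK; congr f; auto.
rewrite opE fK /ext_op /= addr0 off_axes0r // addbF addbA addbb E.
by rewrite addFb -surjective_pairing gK.
Qed.

(** Shifting the fiber over [x] by the indicator of [t] absorbs the coboundary. *)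
Lemma twist_iso s t th : bijective s -> {morph s : x y / x + y} ->
  loop_isomorphic (ext_op (twist s t th)) (ext_op th).
Proof.
move=> [s' sK s'K] sM; exists (fun x => (s x.1, x.2 (+) (x.1 \in t))).
  exists (fun x => (s' x.1, x.2 (+) (s' x.1 \in t))) => -[x b] /=.
    by rewrite sK addbK.
  by rewrite s'K addbK.
move=> [x b] [y c]; rewrite /ext_op /= sM inE /=; congr (_, _).
by case: b c (x \in t) (y \in t) (x + y \in t) ((s x, s y) \in th) => [] [] [] [] [] [].
Qed.

(** An isomorphism fixes [(0, true)], hence commutes with shifts of the second coordinate and is
    determined by its values at [(x, false)]: their first coordinates give [s], their second
    coordinates give [t]. *)
Lemma iso_twist th th' : (forall x : V, x + x = 0 -> x = 0) ->
  th \subset off_axes -> th' \subset off_axes ->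
  loop_isomorphic (ext_op th) (ext_op th') ->
  exists s t, [/\ injective s, {morph s : x y / x + y}, t \subset [set~ 0]
                & th = twist s t th'].
Proof.
move=> V2 thN th'N [f /bij_inj fI fM].
have L := ext_loop thN; have L' := ext_loop th'N.
have f0 : f (0, false) = (0, false).
  by apply: (loopI L' (x := f (0, false))); rewrite -fM (loop1x L) (loopx1 L').
(* [(0, true)] is the only involution, because [V] has none. *)
have f1 : f (0, true) = (0, true).
  have := fM (0, true) (0, true).
  rewrite {1}/ext_op /= addr0 off_axes0l // f0.
  case E: (f (0, true)) => [x b] [/esym/V2 x0 _]; rewrite x0 in E *.
  by case: b E => // /esym; rewrite -f0 => /fI.
have fE x b : f (x, b) = ((f (x, false)).1, (f (x, false)).2 (+) b).
  have -> : (x, b) = ext_op th (x, false) (0, b).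
    by rewrite /ext_op /= addr0 off_axes0r // addbF.
  rewrite fM; have -> : f (0, b) = (0, b) by case: b.
  by rewrite /ext_op /= !addr0 !off_axes0r // !addbF.
exists (fun x => (f (x, false)).1), [set x | (f (x, false)).2].
have fM' x y : f (x + y, (x, y) \in th) = ext_op th' (f (x, false)) (f (y, false)).
  by rewrite -fM.
split.
- move=> x y E; have : f (x, (f (x, false)).2) = f (y, (f (y, false)).2).
    by rewrite (fE x (f (x, false)).2) (fE y (f (y, false)).2) E !addbb.
  by move/fI=> [].
- by move=> x y; have := fM' x y; rewrite (fE _ (_ \in _)) => -[].
- by apply/subsetP=> x; rewrite !inE; apply: contraL => /eqP ->; rewrite f0.
- apply/setP=> -[x y]; rewrite !inE /=; have := fM' x y; rewrite (fE _ (_ \in _)) => -[_].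
  by move/(canRL (addKb _)) ->; rewrite addbCA [RHS]addbCA; congr (_ (+) _); exact: addbC.
Qed.

End Extension.

(** A section [s] of the quotient by a central involution [a] identifies [T] with ['F_q * bool]; the
    cocycle records where [s] fails to be multiplicative. *)
Lemma ext_of_nilpotent q (T : finType) (op : T -> T -> T) (e : T) :
  prime q -> odd q -> #|T| = (2 * q)%N -> nilpotent_loop op e ->
  exists2 th : {set 'F_q * 'F_q},
    th \subset off_axes 'F_q & loop_isomorphic (ext_op th) op.
Proof.
move=> q_pr q_odd Tq [opL [n nilT]]; have q_gt1 := prime_gt1 q_pr.
have T2 : (2 < #|T|)%N by rewrite Tq -[X in (X < _)%N]muln1 ltn_pmul2l.
have [c cC ce] := nilpotent_central_neq1 opL nilT (ltnW T2).
have [a aC [ae aa]] := central_involution opL q_pr q_odd Tq cC ce.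
have [b bA bN] := nilpotent_nuclear_mod_involution opL aC ae nilT T2.
have [s [s0 sM sI]] := cyclic_section opL aC ae aa q_pr Tq bA bN.
pose d (x : bool) := if x then a else e.
have dA x : d x \in [set e; a] by case: x; rewrite !inE eqxx ?orbT.
have dC x : central op (d x) by case: x => //; exact: (central1 opL).
have dM x y : op (d x) (d y) = d (x (+) y).
  by case: x y => [] []; rewrite /d /= ?aa ?(loop1x opL) ?(loopx1 opL).
have dI : injective d.
  by move=> [] [] //= => /eqP; rewrite /d ?(negPf ae) // eq_sym (negPf ae).
pose th := [set u : 'F_q * 'F_q | op (s u.1) (s u.2) != s (u.1 + u.2)].
have sE i j : op (s i) (s j) = op (s (i + j)) (d ((i, j) \in th)).
  rewrite inE /=; case: (sM i j) => _ /set2P[] -> ->.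
    by rewrite (loopx1 opL) eqxx (loopx1 opL).
  suff -> : op (s (i + j)) a != s (i + j) by [].
  apply: contraNneq ae; rewrite -[RHS](loopx1 opL) => /(loopI opL) ->; exact: eqxx.
exists th.
  apply/subsetP=> -[i j]; rewrite !inE /= -negb_or; apply: contra.
  by case/orP=> /eqP ->; rewrite s0 ?add0r ?addr0 ?(loop1x opL) ?(loopx1 opL).
exists (fun x => op (s x.1) (d x.2)).
  apply: inj_card_bij => [[i x] [j y] /= E|].
    have ij := sI _ _ _ _ (dA x) (dA y) E; rewrite ij in E *.
    by move/(loopI opL)/dI: E => ->.
  by rewrite Tq card_prod card_bool card_Fp // mulnC.
move=> [i x] [j y] /=.
rewrite (central_comm (dC x)) (central_comm (dC y)) (central_pull_mull (dC x)).
rewrite (central_pull_mulr (dC y)) sE !(central_comm (dC _)) -addbA -dM.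
by rewrite (central_pull_mull (dC x)) -dM (central_pull_mull (dC y)).
Qed.

Local Close Scope ring_scope.

(** * Orbit counting *)

Lemma leq_card_bigcup (I T : finType) (P : pred I) (F : I -> {set T}) :
  #|\bigcup_(i | P i) F i| <= \sum_(i | P i) #|F i|.
Proof.
elim/big_ind2: _ => [|m A n B le_m le_n|//]; first by rewrite cards0.
by apply: leq_trans (leq_card_setU _ _).1 _; apply: leq_add.
Qed.

Section OrbitCounting.
Variables (I X Y : finType) (act : I -> X -> X) (f : X -> Y).
Variables (G : {set I}) (S : {set X}).
Hypothesis fibers :
  {in S, forall x, [set y in S | f y == f x] = [set act g x | g in G]}.

Let card_fibers : #|S| = \sum_(y in f @: S) #|[set x in S | f x == y]|.
Proof.
rewrite -sum1_card (partition_big_imset f) /=; apply: eq_bigr => y _.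
by rewrite -sum1_card; apply: eq_bigl => x; rewrite !inE.
Qed.

Lemma leq_card_orbits : #|S| <= #|f @: S| * #|G|.
Proof.
rewrite card_fibers -sum_nat_const; apply: leq_sum => _ /imsetP[x xS ->].
by rewrite fibers // leq_imset_card.
Qed.

(** The classes of these points have full size [#|G|]. *)
Definition free_points := [set x in S | dinjectiveb (act^~ x) G].

Lemma card_free_orbits : #|f @: free_points| * #|G| <= #|S|.
Proof.
rewrite card_fibers [leqRHS](bigID (mem (f @: free_points))) /=.
apply: leq_trans (leq_addr _ _); rewrite -sum_nat_const.
rewrite [leqRHS](eq_bigl (mem (f @: free_points))) => [|y /=]; last first.
  apply: andb_idl; apply: subsetP y; apply: imsetS.
  by apply/subsetP=> x; rewrite inE => /andP[].
apply: leq_sum => _ /imsetP[x /setIdP[xS /dinjectiveP xI] ->].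
by rewrite fibers // card_in_imset.
Qed.

(** At a nonfree point some two distinct members of [G] coincide; the union bound runs over all such
    pairs. *)
Lemma card_nonfree_points k :
  {in G &, forall g h, g != h -> #|[set x in S | act g x == act h x]| <= k} ->
  #|S :\: free_points| <= #|G| ^ 2 * k.
Proof.
move=> bound.
pose F (u : I * I) := [set x in S | act u.1 x == act u.2 x].
pose P (u : I * I) := [&& u.1 \in G, u.2 \in G & u.1 != u.2].
have sub : S :\: free_points \subset \bigcup_(u | P u) F u.
  apply/subsetP=> x; rewrite !inE => /andP[nfree xS]; rewrite xS /= in nfree.
  case/dinjectivePn: nfree => g gG [h /andP[/= hg hG] E].
  apply/bigcupP; exists (g, h); first by rewrite /P /= gG hG eq_sym.
  by rewrite inE xS /= E.
apply: leq_trans (subset_leq_card sub) _; apply: leq_trans (leq_card_bigcup _ _) _.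
apply: (@leq_trans (\sum_(u in setX G G) k)); last first.
  by rewrite sum_nat_const cardsX mulnn.
rewrite [leqRHS](bigID (fun u => u.1 != u.2)) /=; apply: leq_trans (leq_addr _ _).
rewrite [leqRHS](eq_bigl P) => [|u]; last by rewrite inE /P andbA.
by apply: leq_sum => -[g h] /and3P[*]; apply: bound.
Qed.

(** There are at most as many classes without free points as nonfree points; the bound
    [#|G| ^ 2 * k] for these, multiplied by [#|G|], gives the cube. *)
Lemma card_orbits_upper k :
  {in G &, forall g h, g != h -> #|[set x in S | act g x == act h x]| <= k} ->
  #|f @: S| * #|G| <= #|S| + #|G| ^ 3 * k.
Proof.
move=> bound; have le : #|f @: S| <= #|f @: free_points| + #|S :\: free_points|.
  have {1}-> : S = free_points :|: (S :\: free_points).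
    by apply/setP=> x; rewrite !inE; case: (x \in S) (dinjectiveb _ _) => [] [].
  rewrite imsetU.
  apply: leq_trans (leq_card_setU _ _).1 _; rewrite leq_add2l; exact: leq_imset_card.
apply: leq_trans (leq_mul le (leqnn _)) _; rewrite mulnDl.
apply: leq_add; first exact: card_free_orbits.
by rewrite expnS mulnC -mulnA leq_mul2l orbC card_nonfree_points.
Qed.

End OrbitCounting.

(** * Counting sets constrained along a self-map *)

Section Descent.
Variables (U : finType) (E : {set U}) (s : U -> U) (B : {set {set U}}).
Hypothesis sE : {in E, forall u, s u \in E}.
Hypothesis BE : {in B, forall A : {set U}, A \subset E}.
Hypothesis Bs : {in B & & E, forall (A A' : {set U}) u,
  (u \in A) (+) (u \in A') = (s u \in A) (+) (s u \in A')}.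

(* Two members of [B] that agree where [r] does not decrease along [s] agree
   everywhere on [E], by induction on [r]. *)
Lemma card_descent (r : U -> nat) : {in E, forall u, r (s u) != r u} ->
  #|B| <= 2 ^ #|[set u in E | r u < r (s u)]|.
Proof.
move=> rs; set D := [set u in E | _].
have I : {in B &, injective (fun A : {set U} => A :&: D)}.
  move=> A A' AB AB' /setP eqD; apply/setP.
  have agree u : u \in E -> (u \in A) = (u \in A').
    elim: {u}_.+1 {-2}u (ltnSn (r u)) => // n IHn u ltn uE.
    have := eqD u; rewrite !inE uE /=; have := rs u uE.
    case: ltngtP => //= [_ _|lt _ _]; first by rewrite !andbT.
    have := Bs AB AB' uE; rewrite (IHn _ (leq_trans lt ltn) (sE uE)) addbb.
    by case: (u \in A) (u \in A') => [] [].
  move=> u; have [/agree //|uE] := boolP (u \in E).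
  by rewrite (contraNF (subsetP (BE AB) u) uE) (contraNF (subsetP (BE AB') u) uE).
rewrite -card_powerset -(card_in_imset I); apply: subset_leq_card.
by apply/subsetP=> _ /imsetP[A _ ->]; rewrite powersetE subsetIr.
Qed.

(** Both ranks [r] and [M - r] fit [card_descent], and the parts of [E] where they increase along
    [s] are disjoint, so the two exponents add up to at most [#|E|]. *)
Lemma card_descent_sqr (r : U -> nat) : {in E, forall u, r (s u) != r u} ->
  #|B| ^ 2 <= 2 ^ #|E|.
Proof.
move=> rs; pose M := \max_u r u; have rM u : r u <= M by apply: leq_bigmax.
have rs' : {in E, forall u, M - r (s u) != M - r u}.
  by move=> u /rs; apply: contra => /eqP E'; rewrite -(subKn (rM u)) -E' subKn.
have disj : [set u in E | r u < r (s u)] :&: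
            [set u in E | M - r u < M - r (s u)] = set0.
  apply/setP=> u; rewrite !inE; apply/negP=> /andP[/andP[_ lt] /andP[_]].
  by rewrite ltnNge leq_sub2l // ltnW.
rewrite -mulnn; apply: leq_trans (leq_mul (card_descent rs) (card_descent rs')) _.
rewrite -expnD leq_pexp2l // -cardsUI disj.
rewrite cards0 addn0; apply: subset_leq_card; apply/subsetP=> u.
by rewrite !inE => /orP[] /andP[].
Qed.

End Descent.

(** * Isomorphism classes of loops of order 2q *)

Lemma loop_isomorphic_sym (T U : Type) (op : T -> T -> T) (op' : U -> U -> U) :
  loop_isomorphic op op' -> loop_isomorphic op' op.
Proof.
move=> [f [g fK gK] fM]; exists g; first by exists f.
by move=> x y; apply: (can_inj fK); rewrite fM !gK.
Qed.

Lemma loop_isomorphic_trans (T U V : Type) (op : T -> T -> T)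
    (op' : U -> U -> U) (op'' : V -> V -> V) :
  loop_isomorphic op op' -> loop_isomorphic op' op'' -> loop_isomorphic op op''.
Proof.
move=> [f fB fM] [g gB gM]; exists (g \o f); first exact: bij_comp.
by move=> x y /=; rewrite fM gM.
Qed.

Section Counting.
Variable q : nat.
Hypotheses (q_pr : prime q) (q_odd : odd q).
Local Notation F := 'F_q.
Local Open Scope ring_scope.

Let cocycles := powerset (off_axes F).

(** A pair consists of the multiplier of an automorphism of [Z/q] and the support of a function
    vanishing at [0], whose coboundary is added. *)
Let gauge : {set F * {set F}} := setX [set~ 0] (powerset [set~ 0]).

Let act (g : F * {set F}) (th : {set F * F}) := twist (fun x => g.1 * x) g.2 th.

Let two_neq0 : 2%:R != 0 :> F.
Proof.
by rewrite -(dvdn_pcharf (pchar_Fp q_pr)) dvdn_prime2 //; apply: contraTneq q_odd => ->.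
Qed.

Let FV2 (x : F) : x + x = 0 -> x = 0.
Proof. by move/eqP; rewrite -mulr2n -mulr_natl mulf_eq0 (negPf two_neq0) => /eqP. Qed.

Lemma additive_Fp (s : F -> F) : {morph s : x y / x + y} -> forall x, s x = s 1 * x.
Proof.
move=> sM x; suff H n : s n%:R = s 1 * n%:R by have := H x; rewrite natr_Zp.
elim: n => [|n IHn].
  by rewrite mulr0; apply: (addrI (s 0)); rewrite -sM !addr0.
by rewrite -natr1 sM IHn mulrDr mulr1.
Qed.

Lemma card_ext_carrier : #|{: F * bool}| = (2 * q)%N.
Proof. by rewrite card_prod card_bool card_Fp // mulnC. Qed.

Let enc (x : F * bool) : 'I_(2 * q) := cast_ord card_ext_carrier (enum_rank x).
Let dec (i : 'I_(2 * q)) : F * bool :=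
  enum_val (cast_ord (esym card_ext_carrier) i).

Let encK : cancel enc dec.
Proof. by move=> x; rewrite /dec cast_ordK enum_rankK. Qed.

Let decK : cancel dec enc.
Proof. by move=> i; rewrite /enc enum_valK cast_ordKV. Qed.

Let ext_table (th : {set F * F}) : table (2 * q) :=
  [ffun u => enc (ext_op th (dec u.1) (dec u.2))].

Let ext_table_iso th : loop_isomorphic (ext_op th) (table_op (ext_table th)).
Proof.
exists enc; first by exists dec.
by move=> x y; rewrite /table_op ffunE /= !encK.
Qed.

(** This is the block of [ext_table th] in the form used by [equivalence_partition], so that
    counting blocks becomes counting values of [iso_class]. *)
Let iso_class (th : {set F * F}) := [set m in nilpotent_tables (2 * q) |
  `[< loop_isomorphic (table_op (ext_table th)) (table_op m) >]].

Let mem_iso_class th m : (m \in iso_class th) = (m \in nilpotent_tables (2 * q)) &&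
  `[< loop_isomorphic (table_op (ext_table th)) (table_op m) >].
Proof. by rewrite [LHS]in_set. Qed.

Let ext_table_nilpotent th : th \in cocycles -> ext_table th \in nilpotent_tables (2 * q).
Proof.
rewrite powersetE => thN; rewrite in_set; apply/asboolP.
exact: nilpotent_of_ext thN (ext_table_iso th).
Qed.

Let iso_class_eq th th' : th \in cocycles -> th' \in cocycles ->
  iso_class th = iso_class th' <-> loop_isomorphic (ext_op th) (ext_op th').
Proof.
move=> thX th'X; split=> [/setP/(_ (ext_table th))|iso].
  rewrite !mem_iso_class ext_table_nilpotent // asboolT; last first.
    by exists id => //; exists id.
  move=> /esym/asboolP H; apply: loop_isomorphic_trans (ext_table_iso _) _.
  exact: loop_isomorphic_trans (loop_isomorphic_sym H)
    (loop_isomorphic_sym (ext_table_iso _)).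
have iso' : loop_isomorphic (table_op (ext_table th)) (table_op (ext_table th')).
  apply: loop_isomorphic_trans (loop_isomorphic_sym (ext_table_iso _)) _.
  exact: loop_isomorphic_trans iso (ext_table_iso _).
apply/setP=> m; rewrite !mem_iso_class; congr (_ && _).
apply/asboolP/asboolP => H; apply: loop_isomorphic_trans H.
  exact: loop_isomorphic_sym iso'.
exact: iso'.
Qed.

(** By [ext_of_nilpotent] every nilpotent table is isomorphic to some [ext_table th], so no other
    blocks occur. *)
Lemma num_nilpotent_loopsE :
  num_nilpotent_loops (2 * q) = #|iso_class @: cocycles|.
Proof.
congr #|pred_of_set _|; apply/setP=> B; apply/imsetP/imsetP => [[m mS ->]|[th thX ->]].
  have := mS; rewrite in_set => /asboolP[e nil_m].
  have [|th thN iso] := ext_of_nilpotent q_pr q_odd _ nil_m.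
    by rewrite card_ord.
  have iso' := loop_isomorphic_trans (loop_isomorphic_sym iso) (ext_table_iso th).
  exists th; first by rewrite powersetE.
  apply/setP=> m'; rewrite [LHS]in_set mem_iso_class; congr (_ && _).
  apply/asboolP/asboolP => H; apply: loop_isomorphic_trans H.
    exact: loop_isomorphic_sym iso'.
  exact: iso'.
by exists (ext_table th) => //; exact: ext_table_nilpotent.
Qed.

(** The coboundary of [t] vanishes on the axes because [0] is not in [t]. *)
Let act_cocycle g th : g \in gauge -> th \in cocycles -> act g th \in cocycles.
Proof.
case: g => c t; rewrite !inE /= => /andP[c0 /subsetP tN] thN.
have t0 : (0 \in t) = false by apply/negP=> /tN; rewrite !inE eqxx.
apply/subsetP=> -[x y]; rewrite !inE /= -negb_or; apply: contraL => /orP[]/eqP ->.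
  by rewrite mulr0 off_axes0l // t0 add0r addbb.
by rewrite mulr0 off_axes0r // t0 addr0 addbF addbb.
Qed.

(** One inclusion is [iso_twist], where [s] is a multiplication by [additive_Fp]; the other is
    [twist_iso]. *)
Let fibers : {in cocycles, forall th,
  [set th' in cocycles | iso_class th' == iso_class th] = [set act g th | g in gauge]}.
Proof.
move=> th thX; apply/setP=> th'; rewrite [LHS]inE; apply/andP/imsetP.
  case=> th'X /eqP/(iso_class_eq th'X thX) iso.
  have [||s [t [sI sM tN ->]]] := iso_twist FV2 _ _ iso.
  - by rewrite powersetE in th'X.
  - by rewrite powersetE in thX.
  have sE := additive_Fp sM; exists (s 1, t).
    rewrite !inE tN andbT; apply/eqP=> s1.
    have : s 1 = s 0 by rewrite (sE 0) mulr0.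
    by move/sI/eqP; rewrite oner_eq0.
  by apply/setP=> u; rewrite !inE /= -!sE.
case=> g gG ->; have gthX := act_cocycle gG thX; split=> //.
apply/eqP/(iso_class_eq gthX thX); move: gG; rewrite !inE => /andP[g0 _].
apply: twist_iso => [|x y]; last exact: mulrDr.
by exists (fun x => g.1^-1 * x) => x; rewrite ?mulKf ?mulVKf.
Qed.

Let card_off_axes : #|off_axes F| = (q.-1 * q.-1)%N.
Proof. by rewrite cardsX cardsC1 card_Fp. Qed.

Let card_gauge : #|gauge| = (q.-1 * 2 ^ q.-1)%N.
Proof. by rewrite cardsX card_powerset cardsC1 card_Fp. Qed.

(** Equal multipliers admit no coincidence. For distinct ones, of ratio [d], a coincidence
    prescribes the sum of the values of the cocycle at [u] and [d u], and [card_descent_sqr]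
    applies. *)
Let coincidence_bound : {in gauge &, forall g h, g != h ->
  (#|[set th in cocycles | act g th == act h th]| ^ 2 <= 2 ^ (q.-1 * q.-1))%N}.
Proof.
move=> [c t] [c' t'] /=; rewrite !inE /= => /andP[c0 tN] /andP[c'0 t'N] ne.
set B := [set th in _ | _].
have Beq th : th \in B -> forall u : F * F,
    ((c * u.1, c * u.2) \in th) (+) ((c' * u.1, c' * u.2) \in th) =
    ((u.1 \in t) (+) (u.1 \in t')) (+) ((u.2 \in t) (+) (u.2 \in t')) (+)
    ((u.1 + u.2 \in t) (+) (u.1 + u.2 \in t')).
  rewrite inE => /andP[_ /eqP/setP E] u; have := E u; rewrite !inE /=.
  by do 8!case: (_ \in _).
have [cc|cc] := eqVneq c c'.
  have [B0|[th thB]] := set_0Vmem B; first by rewrite B0 cards0.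
  have tt x : (x \in t) = (x \in t').
    (* At this point the first two coboundary terms cancel and only the term at [x] remains. *)
    have := Beq _ thB (x / 2%:R, x / 2%:R); rewrite /= cc !addbb /=.
    have -> : x / 2%:R + x / 2%:R = x.
      by rewrite -mulr2n -(mulr_natr (x / 2%:R)) divfK.
    by case: (x \in t) (x \in t') => [] [].
  by case/eqP: ne; rewrite cc; congr (_, _); apply/setP.
rewrite -card_off_axes.
have [d dE d0] : exists2 d, d = c^-1 * c' & d != 0.
  by exists (c^-1 * c') => //; rewrite mulf_neq0 ?invr_eq0.
(* The representative of the first coordinate serves as rank: multiplication by [d], which differs
   from [1], moves every nonzero element. *)
apply: (@card_descent_sqr _ _ (fun u => (d * u.1, d * u.2)) B _ _ _
          (fun u => nat_of_ord u.1)).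
- by move=> [x y]; rewrite !inE !mulf_eq0 /= (negPf d0).
- by move=> th; rewrite !inE => /andP[].
- move=> th th' u thB th'B _.
  (* Evaluation at [c^-1 u] compares the values at [u] and [d u]; the right side of [Beq] does not
     involve the cocycle, so it is the same for [th] and [th']. *)
  have := Beq _ thB (c^-1 * u.1, c^-1 * u.2); have := Beq _ th'B (c^-1 * u.1, c^-1 * u.2).
  rewrite /= !mulVKf // !mulrA ![c' * _]mulrC -dE -!surjective_pairing => <-.
  by do 4!case: (_ \in _).
- move=> [x y]; rewrite !inE => /andP[/= x0 _]; apply: contra cc => /eqP H.
  have E : d * x = x by apply: ord_inj.
  have /eqP : d = 1 by apply: (mulIf x0); rewrite mul1r.
  by rewrite dE -(inj_eq (mulfI c0)) mulVKf // mulr1 eq_sym.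
Qed.

Local Close Scope ring_scope.

Lemma num_nilpotent_loops_lower :
  2 ^ (q.-1 * q.-1) <= num_nilpotent_loops (2 * q) * (q.-1 * 2 ^ q.-1).
Proof.
have := leq_card_orbits fibers; rewrite card_powerset card_off_axes card_gauge.
by rewrite -num_nilpotent_loopsE.
Qed.

(** Here [k] stands for an integer bound on a square root, since [coincidence_bound] controls the
    square of the number of coincidences. *)
Lemma num_nilpotent_loops_upper k : (forall n, n ^ 2 <= 2 ^ (q.-1 * q.-1) -> n <= k) ->
  num_nilpotent_loops (2 * q) * (q.-1 * 2 ^ q.-1) <=
  2 ^ (q.-1 * q.-1) + (q.-1 * 2 ^ q.-1) ^ 3 * k.
Proof.
move=> bound; rewrite num_nilpotent_loopsE -card_gauge -[X in 2 ^ X]card_off_axes.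
rewrite -card_powerset.
apply: (card_orbits_upper fibers) => g h gG hG ne.
exact/bound/coincidence_bound.
Qed.

End Counting.

(** * Estimates and the limit *)

Lemma num_nilpotent_loops_sharp q : prime q -> odd q -> 17 <= q ->
  num_nilpotent_loops (2 * q) * (q.-1 * 2 ^ q.-1) * 2 ^ q <=
  2 ^ (q.-1 * q.-1) * (2 ^ q).+1.
Proof.
move=> q_pr q_odd q_ge; pose r := q./2.
have qE : q = r.*2.+1 by rewrite -[LHS]odd_double_half q_odd.
(* The final comparison of exponents, [12 r + 2 r^2 + (2 r + 1) <= 4 r^2], holds from [r = 8] on,
   whence the threshold 17. *)
have r_ge : 8 <= r by move: q_ge; rewrite qE; lia.
(* As [(q - 1)^2 = 4 r^2], the square root is exactly [2^(2 r^2)]. *)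
have bound n : n ^ 2 <= 2 ^ (q.-1 * q.-1) -> n <= 2 ^ (r.*2 * r).
  have -> : q.-1 * q.-1 = (r.*2 * r) * 2 by rewrite qE /= -!muln2; lia.
  by rewrite expnM leq_sqr.
have := num_nilpotent_loops_upper q_pr q_odd bound.
rewrite -(leq_pmul2r (expn_gt0 2 q : 0 < 2 ^ q)) => /leq_trans; apply.
rewrite mulnDl mulnS addnC leq_add2r.
have le_pow : (q.-1 * 2 ^ q.-1) ^ 3 <= 2 ^ (q.-1 * 6).
  by rewrite (mulnA _ 2 3) expnM leq_exp2r // muln2 -addnn expnD
              leq_mul2r orbC (ltnW (ltn_expl _ _)).
apply: leq_trans (leq_mul (leq_mul le_pow (leqnn _)) (leqnn _)) _.
by rewrite -!expnD leq_pexp2l // qE /= -!muln2; nia.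
Qed.

Import Order.TTheory GRing.Theory Num.Theory numFieldNormedType.Exports.
Local Open Scope classical_set_scope.
Local Open Scope ring_scope.

Theorem theorem7p3 (R : realType) :
  (fun q : nat => (num_nilpotent_loops (2 * q))%:R
     * ((q%:R - 1) / 2 ^+ ((q - 2) * (q - 1))) : R)
    @ within [set q : nat | prime q /\ odd q] \oo --> (1 : R).
Proof.
(* This majorant is the ratio [(2^q + 1) / 2^q] from [num_nilpotent_loops_sharp]; the minorant [1]
   comes from [num_nilpotent_loops_lower]. *)
pose h q : R := 1 + 2^-1 ^+ q.
have hE : h @ within [set q : nat | prime q /\ odd q] \oo --> (1 : R).
  apply: cvg_within_filter; have -> : (1 : R) = 1 + 0 by rewrite addr0.
  apply: cvgD; first exact: cvg_cst.
  by apply: cvg_expr; rewrite ger0_norm ?invr_ge0 // invf_lt1 // ltr1n.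
apply: (@squeeze_cvgr _ _ _ _ (fun=> 1) h); [|exact: cvg_cst|exact: hE].
rewrite near_withinE; near=> q => -[q_pr q_odd].
have q17 : (17 <= q)%N by near: q; exact: nbhs_infty_ge.
have q_gt1 := prime_gt1 q_pr.
(* Splitting the exponent isolates the factor [2 ^ q.-1], which cancels against the number of
   coboundaries. *)
have pE : (q.-1 * q.-1 = (q - 2) * (q - 1) + q.-1)%N by nia.
have pR : q%:R - 1 = q.-1%:R :> R by rewrite -subn1 natrB // ltnW.
have X_gt0 : (0 : R) < 2 ^+ ((q - 2) * (q - 1)) by rewrite exprn_gt0.
have P_gt0 : (0 : R) < 2 ^+ q.-1 by rewrite exprn_gt0.
have Q_gt0 : (0 : R) < 2 ^+ q by rewrite exprn_gt0.
have := num_nilpotent_loops_lower q_pr q_odd.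
have := num_nilpotent_loops_sharp q_pr q_odd q17.
rewrite pE expnD -!(ler_nat R) !natrM mulrSr !natrX pR.
rewrite mulrA -mulrA (mulrCA _ (2 ^+ q.-1)) => U L.
rewrite mulrA ler_pdivlMr // mul1r -(ler_pM2r P_gt0) L /= ler_pdivrMr //.
rewrite -(ler_pM2r Q_gt0) -(ler_pM2l P_gt0); apply: le_trans U _.
rewrite /h exprVn le_eqVlt; apply/orP; left; apply/eqP.
by field; rewrite expf_neq0 // pnatr_eq0.
Unshelve. all: by end_near.
Qed.
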